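(* Let $\Gamma$ be a compact metric graph, $d\ge0$, and let $T\subseteq\mathrm{Div}^d_{+,\mathbb R}(\Gamma)$ be a tropical convex hull generated by a finite set. Then $T$ has only finitely many extremals; the set $S$ of all extremals of $T$ satisfies $\mathrm{tconv}(S)=T$, and $S$ is minimal among all generating sets of $T$ (every $S'$ with $\mathrm{tconv}(S')=T$ contains $S$).
   Context: $\Gamma$ is a compact metric graph (finitely many edges of finite length). An $\mathbb R$-divisor is a finite formal sum $\sum_p m_p(p)$, $m_p\in\mathbb R$, $p\in\Gamma$; effective means all $m_p\ge0$; degree is $\sum m_p$. $\mathrm{Div}^d_{+,\mathbb R}(\Gamma)$ is the set of effective $\mathbb R$-divisors of degree $d$. For a continuous piecewise-linear $f$ on $\Gamma$, $\Delta f=\sum_p\sigma_p(f)(p)$ where $-\sigma_p(f)$ is the sum of the outgoing slopes of $f$ at $p$. For effective $D_1,D_2$ of equal degree, $f_{D_2-D_1}$ is a continuous piecewise-linear function with $\Delta f_{D_2-D_1}=D_2-D_1$ (unique up to additive constant). $\rho(D_1,D_2)=\max f_{D_2-D_1}-\min f_{D_2-D_1}$. The tropical segment $\mathrm{tconv}(D_1,D_2)$ is the image of $t\mapsto D_1+\Delta\min(t\rho(D_1,D_2),f_{D_2-D_1}-\min f_{D_2-D_1})$, $t\in[0,1]$. A set is tropically convex if it contains $\mathrm{tconv}(D_1,D_2)$ for any two of its elements; $\mathrm{tconv}(S)$ is the intersection of all tropically convex sets containing $S$, and $S$ is then called a generating set of $\mathrm{tconv}(S)$. For a tropically convex $T$,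 an element $D\in T$ is an extremal of $T$ if $D\notin\mathrm{tconv}(T\setminus\{D\})$. *)

(* Defs.v *)
From HB Require Import structures.
From mathcomp Require Import all_boot all_order all_algebra.
From mathcomp Require Import all_classical all_reals all_analysis.

Set Implicit Arguments.
Unset Strict Implicit.
Unset Printing Implicit Defensive.

Import Order.TTheory GRing.Theory Num.Theory.
Import numFieldNormedType.Exports.

Local Open Scope classical_set_scope.
Local Open Scope ring_scope.

(* A compact connected metric graph, given by a finite model: the edge [e] is a
   segment of length [len e] glued at its ends to [src e] and [tgt e].  Loops
   and multiple edges are allowed; the orientation of the edges only serves to
   parametrize them.  The model may be refined at will by adding vertices of
   valence two. *)
Record metric_graph (R : realType) := MetricGraph {
  vertex : finType;
  edge : finType;
  src : edge -> vertex;
  tgt : edge -> vertex;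
  len : edge -> R;
  len_gt0 : forall e, 0 < len e;
  vertex_neq0 : (0 < #|vertex|)%N;
  graph_connected : forall u v : vertex,
    connect (fun a b => [exists e, ((src e == a) && (tgt e == b))
                                || ((src e == b) && (tgt e == a))]) u v
}.

Section MetricGraph.
Variables (R : realType) (G : metric_graph R).

Inductive gpoint : Type :=
| Vertex of vertex G
| Inner (e : edge G) (x : R) of 0 < x < len e.

HB.instance Definition _ := gen_eqMixin gpoint.
HB.instance Definition _ := gen_choiceMixin gpoint.

(* The point of the closed edge [e] at distance [x] from its source along [e];
   only meant for 0 <= x <= len e. *)
Definition edge_pt (e : edge G) (x : R) : gpoint :=
  match pselect (0 < x < len e) with
  | left x_inner => Inner x_inner
  | right _ => if x <= 0 then Vertex (src e) else Vertex (tgt e)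
  end.

(* Continuous piecewise-linear functions: every closed edge carries finitely
   many breakpoints such that the function is affine on each closed subsegment
   with no breakpoint in its interior.  Continuity is built in, because these
   subsegments are closed and because the values at the two ends of an edge are
   the values at its end vertices. *)
Definition piecewise_linear (f : gpoint -> R) : Prop :=
  forall e : edge G, exists s : seq R, forall a b : R,
    0 <= a -> a < b -> b <= len e ->
    (forall c, c \in s -> ~~ (a < c < b)) ->
    exists m k : R, forall x, a <= x <= b -> f (edge_pt e x) = m * x + k.

Definition slope_fwd (f : gpoint -> R) (e : edge G) (x : R) : R :=
  lim ((f (edge_pt e (x + h)) - f (edge_pt e x)) / h @[h --> 0^'+]).

Definition slope_bwd (f : gpoint -> R) (e : edge G) (x : R) : R :=
  lim ((f (edge_pt e (x - h)) - f (edge_pt e x)) / h @[h --> 0^'+]).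

(* A loop contributes two outgoing directions at its vertex. *)
Definition outgoing_slopes (f : gpoint -> R) (p : gpoint) : R :=
  match p with
  | Vertex v => \sum_(e | src e == v) slope_fwd f e 0
              + \sum_(e | tgt e == v) slope_bwd f e (len e)
  | Inner e x _ => slope_fwd f e x + slope_bwd f e x
  end.

(* The formal sum \sum_p m_p (p) is encoded by the function p |-> m_p; finiteness
   of the support is required in [eff_div]. *)
Definition divisor : Type := gpoint -> R.

Definition laplacian (f : gpoint -> R) : divisor :=
  fun p => - outgoing_slopes f p.

Definition degree (D : divisor) : R := \sum_(p \in [set: gpoint]) D p.

Definition eff_div (d : R) : set divisor :=
  [set D | [/\ finite_set [set p | D p != 0], forall p, 0 <= D p
             & degree D = d]].

(* [sup] and [inf] are attained on continuous piecewise-linear functions. *)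
Definition fmax (f : gpoint -> R) : R := sup (range f).
Definition fmin (f : gpoint -> R) : R := inf (range f).

(* [f] is a function f_D; it is unique up to an additive constant. *)
Definition is_potential (D : divisor) (f : gpoint -> R) : Prop :=
  piecewise_linear f /\ laplacian f = D.

(* With f = f_{D2 - D1}, the difference [fmax f - fmin f] is rho(D1, D2). *)
Definition tpath (D1 : divisor) (f : gpoint -> R) (t : R) : divisor :=
  D1 \+ laplacian (fun p => Num.min (t * (fmax f - fmin f)) (f p - fmin f)).

(* [tpath D1 f] is unchanged when a constant is added to [f], so the choice of
   f_{D2 - D1} is irrelevant. *)
Definition tsegment (D1 D2 : divisor) : set divisor :=
  [set D | exists2 f, is_potential (D2 \- D1) f & (tpath D1 f @` `[0, 1]) D].

Definition tconvex (d : R) (T : set divisor) : Prop :=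
  T `<=` eff_div d /\
  forall D1 D2, T D1 -> T D2 -> tsegment D1 D2 `<=` T.

(* [smallest C S] is the intersection of all sets satisfying [C] and
   containing [S]. *)
Definition tconv (d : R) (S : set divisor) : set divisor :=
  smallest (tconvex d) S.

Definition extremals (d : R) (T : set divisor) : set divisor :=
  [set D | T D /\ ~ tconv d (T `\ D) D].

End MetricGraph.

(* Main.v *)
Require Import Defs.
From mathcomp Require Import all_boot all_order all_algebra.
From mathcomp Require Import all_classical all_reals all_analysis.
From mathcomp Require Import ring lra.

Import Order.TTheory GRing.Theory Num.Theory.
Import numFieldNormedType.Exports.

Local Open Scope classical_set_scope.
Local Open Scope ring_scope.

(** Relative to a fixed divisor [D], an element [D + laplacian h] of [eff_div d]
    is encoded by its potential [h], which is unique up to a constant, and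
    tropical convexity becomes stability of the set of potentials under [min].
    Let the finite set [S] generate [T], let [D] be in [S], and let [T'] be the
    hull of [S] without [D].  The potentials of [T] linked to [D] are then the
    constants and the functions [min c g] with [g] a potential of [T'].  If [D]
    is not in [T'], this description shows that no segment with both ends in
    [T] different from [D] meets [D], so [D] is extremal.  Hence every
    non-extremal generator can be dropped, and finitely many such steps leave a
    generating set made of extremals. *)

(** * Piecewise linear functions on a segment *)

Section Segment.
Variable R : realType.
Implicit Types (f g : R -> R) (a b c x : R) (s : seq R) (A : R -> R -> Prop).

Definition affine_on f a b :=
  exists m k : R, forall x, a <= x <= b -> f x = m * x + k.

(** With [A] the affineness of [f] read along an edge, this unfolds to the clause of
    [piecewise_linear]. The general [A] allows two functions to be treated on common pieces. *)
Definition pieces A a b s := forall a' b',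
  a <= a' -> a' < b' -> b' <= b -> (forall c, c \in s -> ~~ (a' < c < b')) ->
  A a' b'.

Lemma pieces_imp A A' a b s :
  (forall a' b', a' < b' -> A a' b' -> A' a' b') ->
  pieces A a b s -> pieces A' a b s.
Proof. by move=> AA' As a' b' ? ? ? H; apply: AA' => //; apply: As. Qed.

Lemma pieces_and A A' a b s s' : pieces A a b s -> pieces A' a b s' ->
  pieces (fun u v => A u v /\ A' u v) a b (s ++ s').
Proof.
move=> As As' a' b' ? ? ? H; split.
  by apply: As => // c cs; apply: H; rewrite mem_cat cs.
by apply: As' => // c cs; apply: H; rewrite mem_cat cs orbT.
Qed.

(** Induction on the breakpoints: one inside the segment cuts it in two, and the remaining list
    serves both halves; one outside is discarded. *)
Lemma pieces_ind A (P : R -> R -> Prop) :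
  (forall a b, a < b -> A a b -> P a b) ->
  (forall a c b, a < c -> c < b -> P a c -> P c b -> P a b) ->
  forall s a b, a < b -> pieces A a b s -> P a b.
Proof.
move=> PA Psplit; elim=> [|c s IH] a b ab As.
  by apply: PA => //; apply: As.
case: (boolP (a < c < b)) => [/andP[ac cb]|acb].
  apply: (Psplit _ c) => //; apply: IH => // a' b' aa' a'b' b'b H.
    apply: As => //; first lra.
    move=> z; rewrite inE => /orP[/eqP->|]; last exact: H.
    by apply/negP; lra.
  apply: As => //; first lra.
  move=> z; rewrite inE => /orP[/eqP->|]; last exact: H.
  by apply/negP; lra.
apply: IH => // a' b' aa' a'b' b'b H; apply: As => // z.
rewrite inE => /orP[/eqP->|]; last exact: H.
by apply: contra acb => /andP[? ?]; apply/andP; split; lra.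
Qed.

Lemma pieces_glue A a c b s s' : pieces A a c s -> pieces A c b s' ->
  pieces A a b (c :: s ++ s').
Proof.
move=> As As' a' b' aa' a'b' b'b H.
have := H c; rewrite inE eqxx => /(_ isT); rewrite negb_and -!leNgt.
case/orP=> ?.
  by apply: As' => // z zs; apply: H; rewrite inE mem_cat zs !orbT.
by apply: As => // z zs; apply: H; rewrite inE mem_cat zs orbT.
Qed.

Lemma affine_on_lin (t : R) f g a b : affine_on f a b -> affine_on g a b ->
  affine_on (fun x => t * f x + g x) a b.
Proof.
move=> [m [k H]] [m' [k' H']]; exists (t * m + m'), (t * k + k') => x xab.
by rewrite H // H' //; ring.
Qed.

Lemma affine_on_min f g a b : affine_on f a b -> affine_on g a b ->
  exists s, pieces (affine_on (fun x => Num.min (f x) (g x))) a b s.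
Proof.
move=> [m [k H]] [m' [k' H']].
have minl u v : a <= u -> v <= b ->
    (forall x, u <= x <= v -> m * x + k <= m' * x + k') ->
    affine_on (fun x => Num.min (f x) (g x)) u v.
  move=> au vb le; exists m, k => x xuv; rewrite H; last lra.
  by rewrite H'; [rewrite min_l // le|lra].
have minr u v : a <= u -> v <= b ->
    (forall x, u <= x <= v -> m' * x + k' <= m * x + k) ->
    affine_on (fun x => Num.min (f x) (g x)) u v.
  move=> au vb le; exists m', k' => x xuv; rewrite H; last lra.
  by rewrite H'; [rewrite min_r // le|lra].
have [mm|mm] := eqVneq m m'.
  exists [::] => u v au uv vb _; case: (leP k k') => kk.
    by apply: minl => // x _; rewrite mm; lra.
  by apply: minr => // x _; rewrite mm; lra.
(* The two lines cross at [z], and the sign of their difference is constant on either side, so [z]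
   is the only breakpoint. *)
pose z := (k' - k) / (m - m').
have dm0 : m - m' != 0 by rewrite subr_eq0.
have dE x : m * x + k - (m' * x + k') = (m - m') * (x - z).
  by rewrite /z; field.
exists [:: z] => u v au uv vb /(_ z); rewrite inE eqxx => /(_ isT).
rewrite negb_and -!leNgt => zuv.
have [mlt|mgt|mE] := ltgtP m m'; last by rewrite mE eqxx in mm.
  case/orP: zuv => zz; [apply: minl => //|apply: minr => //] => x xuv;
    have := dE x.
    by have : (m - m') * (x - z) <= 0; nra.
  by have : 0 <= (m - m') * (x - z); nra.
case/orP: zuv => zz; [apply: minr => //|apply: minl => //] => x xuv;
  have := dE x.
  by have : 0 <= (m - m') * (x - z); nra.
by have : (m - m') * (x - z) <= 0; nra.
Qed.

Lemma pieces_min f g a b s : a < b ->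
  pieces (fun u v => affine_on f u v /\ affine_on g u v) a b s ->
  exists s', pieces (affine_on (fun x => Num.min (f x) (g x))) a b s'.
Proof.
move: s a b; apply: pieces_ind => [a b _ [] |a c b _ _ [s Hs] [s' Hs']].
  exact: affine_on_min.
by exists (c :: s ++ s'); apply: pieces_glue.
Qed.

Lemma pieces_bounded f a b s : a < b -> pieces (affine_on f) a b s ->
  exists M, forall x, a <= x <= b -> `|f x| <= M.
Proof.
move: s a b; apply: pieces_ind => [a b _ [m [k H]] |a c b ? ? [M HM] [N HN]].
  exists (`|m| * (`|a| + `|b|) + `|k|) => x xab; rewrite H //.
  rewrite (le_trans (ler_normD _ _))// lerD2r normrM ler_wpM2l//.
  by rewrite ler_norml; have := ler_norm a; have := ler_norm (- a);
     have := ler_norm b; have := ler_norm (- b); rewrite !normrN; lra.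
exists (`|M| + `|N|) => x xab; have := ler_norm M; have := ler_norm N.
have := normr_ge0 M; have := normr_ge0 N.
by case: (leP x c) => ?; [have := HM x|have := HN x]; lra.
Qed.

(** * One-sided slopes *)

Definition germ_right f x (m : R) := exists2 r : R, 0 < r &
  forall h, 0 <= h <= r -> f (x + h) = f x + m * h.

(** As on the right, [m] is the outgoing slope, so an affine piece of slope [m] has left germ [- m].
    Exact linearity on a short interval makes the quotients in [slope_fwd] and [slope_bwd] constant
    for small [h]. *)
Definition germ_left f x (m : R) := exists2 r : R, 0 < r &
  forall h, 0 <= h <= r -> f (x - h) = f x + m * h.

Lemma affine_germ_right f a b x m k : a <= x < b ->
  (forall y, a <= y <= b -> f y = m * y + k) -> germ_right f x m.
Proof.
move=> xab H; exists (b - x) => [|h hr]; first lra.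
by rewrite !H; [ring|lra|lra].
Qed.

Lemma affine_germ_left f a b x m k : a < x <= b ->
  (forall y, a <= y <= b -> f y = m * y + k) -> germ_left f x (- m).
Proof.
move=> xab H; exists (x - a) => [|h hr]; first lra.
by rewrite !H; [ring|lra|lra].
Qed.

Lemma pieces_germ_right f a b s : a < b -> pieces (affine_on f) a b s ->
  forall x, a <= x < b -> exists m, germ_right f x m.
Proof.
move: s a b; apply: pieces_ind => [a b ab [m [k H]] x xab|a c b ? ? H H' x xab].
  by exists m; apply: (affine_germ_right _ _ _ _ _ _ xab H).
by case: (ltP x c) => ?; [apply: H; lra|apply: H'; lra].
Qed.

Lemma pieces_germ_left f a b s : a < b -> pieces (affine_on f) a b s ->
  forall x, a < x <= b -> exists m, germ_left f x m.
Proof.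
move: s a b; apply: pieces_ind => [a b ab [m [k H]] x xab|a c b ? ? H H' x xab].
  by exists (- m); apply: (affine_germ_left _ _ _ _ _ _ xab H).
by case: (leP x c) => ?; [apply: H; lra|apply: H'; lra].
Qed.

(** Two adjacent affine pieces agree at their common end; when the outgoing slopes cancel there,
    they lie on the same line. *)
Lemma pieces_smooth f a b s : a < b -> pieces (affine_on f) a b s ->
  (forall x m m', a < x < b -> germ_right f x m -> germ_left f x m' ->
     m + m' = 0) ->
  affine_on f a b.
Proof.
move: s a b; apply: pieces_ind => [//|a c b ac cb IH1 IH2 H].
have [|m1 [k1 H1]] := IH1.
  by move=> x m m' ?; apply: H; lra.
have [|m2 [k2 H2]] := IH2.
  by move=> x m m' ?; apply: H; lra.
have mE : m2 + - m1 = 0.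
  apply: (H c); first lra.
    by apply: (affine_germ_right _ c b _ _ _ _ H2); lra.
  by apply: (affine_germ_left _ a c _ _ _ _ H1); lra.
have {}mE : m2 = m1 by lra.
have kE : k2 = k1.
  have := H1 c; rewrite H2; last lra.
  by rewrite mE => E; have := E ltac:(lra); lra.
exists m1, k1 => x xab; case: (leP x c) => ?; first by apply: H1; lra.
by rewrite H2 ?mE ?kE //; lra.
Qed.

End Segment.

(** * Piecewise linear functions on a metric graph *)

Section Graph.
Variables (R : realType) (G : metric_graph R).
Implicit Types (f g h : gpoint G -> R) (p : gpoint G) (e : edge G).

Lemma edge_pt0 e : edge_pt e 0 = Vertex (src e).
Proof.
rewrite /edge_pt; case: pselect => [xe|_]; last by rewrite lexx.
by have := xe; rewrite ltxx.
Qed.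

Lemma edge_pt_len e : edge_pt e (len e) = Vertex (tgt e).
Proof.
rewrite /edge_pt; case: pselect => [xe|_]; last by rewrite leNgt len_gt0.
by have := xe; rewrite ltxx andbF.
Qed.

Lemma Inner_edge_pt e x (xe : 0 < x < len e) : Inner xe = edge_pt e x.
Proof.
rewrite /edge_pt; case: pselect => // xe'; congr Inner.
exact: bool_irrelevance.
Qed.

Lemma pl_lin (t : R) f g : piecewise_linear f -> piecewise_linear g ->
  piecewise_linear (fun p => t * f p + g p).
Proof.
move=> plf plg e; have [s Hs] := plf e; have [s' Hs'] := plg e.
exists (s ++ s'); apply: pieces_imp (pieces_and _ _ _ _ _ _ _ Hs Hs') => a b _ [].
exact: affine_on_lin.
Qed.

Lemma pl_cst (k : R) : piecewise_linear (fun _ : gpoint G => k).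
Proof.
by move=> e; exists [::] => a b *; exists 0, k => x _; rewrite mul0r add0r.
Qed.

Lemma pl_add f g : piecewise_linear f -> piecewise_linear g ->
  piecewise_linear (fun p => f p + g p).
Proof.
move=> plf plg; rewrite (_ : (fun p => _) = fun p => 1 * f p + g p).
  exact: pl_lin.
by apply/funext => p; rewrite mul1r.
Qed.

Lemma pl_sub f g : piecewise_linear f -> piecewise_linear g ->
  piecewise_linear (fun p => f p - g p).
Proof.
move=> plf plg; rewrite (_ : (fun p => _) = fun p => -1 * g p + f p).
  exact: pl_lin.
by apply/funext => p; ring.
Qed.

Lemma pl_min f g : piecewise_linear f -> piecewise_linear g ->
  piecewise_linear (fun p => Num.min (f p) (g p)).
Proof.
move=> plf plg e; have [s Hs] := plf e; have [s' Hs'] := plg e.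
exact: pieces_min (len_gt0 e) (pieces_and _ _ _ _ _ _ _ Hs Hs').
Qed.

Lemma pl_bounded f : piecewise_linear f -> exists M, forall p, `|f p| <= M.
Proof.
move=> plf.
have /choice[M HM] : forall e, exists M, forall x, 0 <= x <= len e ->
    `|f (edge_pt e x)| <= M.
  by move=> e; have [s Hs] := plf e; apply: pieces_bounded (len_gt0 e) Hs.
exists (\sum_v `|f (Vertex v)| + \sum_e `|M e|) => -[v|e x xe].
  rewrite (bigD1 v) //= -addrA lerDl addr_ge0 //; first exact: sumr_ge0.
  exact: sumr_ge0.
rewrite (bigD1 e) //= Inner_edge_pt addrCA (le_trans (HM e x _)) //; first lra.
by rewrite (le_trans (ler_norm _)) // lerDl addr_ge0 // sumr_ge0.
Qed.

(** * Slopes and the Laplacian *)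

Lemma slope_fwdE f e x (m : R) : germ_right _ (fun y => f (edge_pt e y)) x m ->
  slope_fwd f e x = m.
Proof.
case=> r r0 H; apply: cvg_lim => //; apply: cvg_near_cst.
near=> h; have h0 : 0 < h by near: h; exact: nbhs_right_gt.
have hr : h < r by near: h; exact: nbhs_right_lt.
rewrite H; first by field; rewrite gt_eqF.
by apply/andP; split; exact: ltW.
Unshelve. all: by end_near. Qed.

Lemma slope_bwdE f e x (m : R) : germ_left _ (fun y => f (edge_pt e y)) x m ->
  slope_bwd f e x = m.
Proof.
case=> r r0 H; apply: cvg_lim => //; apply: cvg_near_cst.
near=> h; have h0 : 0 < h by near: h; exact: nbhs_right_gt.
have hr : h < r by near: h; exact: nbhs_right_lt.
rewrite H; first by field; rewrite gt_eqF.
by apply/andP; split; exact: ltW.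
Unshelve. all: by end_near. Qed.

Lemma slope_fwd_lin (t : R) f g e x : piecewise_linear f ->
  piecewise_linear g -> 0 <= x < len e ->
  slope_fwd (fun p => t * f p + g p) e x = t * slope_fwd f e x + slope_fwd g e x.
Proof.
move=> /(_ e)[s Hs] /(_ e)[s' Hs'] xe.
have [m Hm] := pieces_germ_right _ _ _ _ _ (len_gt0 e) Hs x xe.
have [m' Hm'] := pieces_germ_right _ _ _ _ _ (len_gt0 e) Hs' x xe.
rewrite (slope_fwdE _ _ _ _ Hm) (slope_fwdE _ _ _ _ Hm'); apply: slope_fwdE.
case: Hm Hm' => r r0 H [r' r'0 H']; exists (Num.min r r') => [|h].
  by rewrite lt_min r0.
rewrite le_min => /and3P[h0 hr hr'].
by rewrite H ?h0 // H' ?h0 //; ring.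
Qed.

Lemma slope_bwd_lin (t : R) f g e x : piecewise_linear f ->
  piecewise_linear g -> 0 < x <= len e ->
  slope_bwd (fun p => t * f p + g p) e x = t * slope_bwd f e x + slope_bwd g e x.
Proof.
move=> /(_ e)[s Hs] /(_ e)[s' Hs'] xe.
have [m Hm] := pieces_germ_left _ _ _ _ _ (len_gt0 e) Hs x xe.
have [m' Hm'] := pieces_germ_left _ _ _ _ _ (len_gt0 e) Hs' x xe.
rewrite (slope_bwdE _ _ _ _ Hm) (slope_bwdE _ _ _ _ Hm'); apply: slope_bwdE.
case: Hm Hm' => r r0 H [r' r'0 H']; exists (Num.min r r') => [|h].
  by rewrite lt_min r0.
rewrite le_min => /and3P[h0 hr hr'].
by rewrite H ?h0 // H' ?h0 //; ring.
Qed.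

Lemma laplacian_lin (t : R) f g p : piecewise_linear f ->
  piecewise_linear g ->
  laplacian (fun p => t * f p + g p) p = t * laplacian f p + laplacian g p.
Proof.
move=> plf plg; rewrite /laplacian; case: p => [v|e x xe] /=.
  rewrite (eq_bigr (fun e => t * slope_fwd f e 0 + slope_fwd g e 0)).
    rewrite (eq_bigr (P := fun e => tgt e == v)
              (fun e => t * slope_bwd f e (len e) + slope_bwd g e (len e))).
      by rewrite !big_split /= -!mulr_sumr; ring.
    by move=> e _; apply: slope_bwd_lin; rewrite // len_gt0 lexx.
  by move=> e _; apply: slope_fwd_lin; rewrite // len_gt0 lexx.
have /andP[x0 xl] := xe.
by rewrite slope_fwd_lin ?slope_bwd_lin ?(ltW x0) ?(ltW xl) ?x0 //; ring.
Qed.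

Lemma laplacian_cst (k : R) p : laplacian (fun _ => k) p = 0.
Proof.
have fwd e x : slope_fwd (fun=> k) e x = 0.
  by apply: slope_fwdE; exists 1 => // h _; rewrite mul0r addr0.
have bwd e x : slope_bwd (fun=> k) e x = 0.
  by apply: slope_bwdE; exists 1 => // h _; rewrite mul0r addr0.
rewrite /laplacian; case: p => [v|e x xe] /=; last by rewrite fwd bwd addr0 oppr0.
by rewrite !big1 ?addr0 ?oppr0.
Qed.

Lemma laplacian_add f g p : piecewise_linear f -> piecewise_linear g ->
  laplacian (fun p => f p + g p) p = laplacian f p + laplacian g p.
Proof.
move=> plf plg; rewrite (_ : (fun p => _) = fun p => 1 * f p + g p).
  by rewrite laplacian_lin // mul1r.
by apply/funext => q; rewrite mul1r.
Qed.

Lemma laplacian_sub f g p : piecewise_linear f -> piecewise_linear g ->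
  laplacian (fun p => f p - g p) p = laplacian f p - laplacian g p.
Proof.
move=> plf plg; rewrite (_ : (fun p => _) = fun p => -1 * g p + f p).
  by rewrite laplacian_lin //; ring.
by apply/funext => q; ring.
Qed.

Lemma laplacian_addc h (l : R) : piecewise_linear h ->
  laplacian (fun p => h p + l) = laplacian h.
Proof.
move=> plh; apply/funext => p.
by rewrite laplacian_add ?laplacian_cst ?addr0 //; apply: pl_cst.
Qed.

(** * Harmonic functions and uniqueness of potentials *)

(* Maximum principle: [f] is affine on every edge, and at a vertex where it is
   maximal all outgoing slopes are nonpositive, hence zero. *)
Lemma harmonic_cst f : piecewise_linear f -> (forall p, laplacian f p = 0) ->
  exists k, forall p, f p = k.
Proof.
move=> plf hf.
have /choice[mk Hmk] : forall e, exists mk : R * R, forall x,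
    0 <= x <= len e -> f (edge_pt e x) = mk.1 * x + mk.2.
  move=> e; have [s Hs] := plf e.
  have [|m [k H]] := pieces_smooth _ _ _ _ _ (len_gt0 e) Hs; last by exists (m, k).
  move=> x m m' xe Hm Hm'.
  have := hf (Inner xe); rewrite /laplacian /=.
  rewrite (slope_fwdE _ _ _ _ Hm) (slope_bwdE _ _ _ _ Hm'); lra.
pose m e := (mk e).1.
have fwd e : slope_fwd f e 0 = m e.
  apply/slope_fwdE/(affine_germ_right _ _ 0 (len e) _ _ _ _ (Hmk e)).
  by rewrite lexx len_gt0.
have bwd e : slope_bwd f e (len e) = - m e.
  apply/slope_bwdE/(affine_germ_left _ _ 0 (len e) _ _ _ _ (Hmk e)).
  by rewrite lexx len_gt0.
have fsrc e : f (Vertex (src e)) = (mk e).2.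
  by rewrite -edge_pt0 Hmk ?lexx ?ltW ?len_gt0 // mulr0 add0r.
have ftgt e : f (Vertex (tgt e)) = m e * len e + f (Vertex (src e)).
  by rewrite fsrc -edge_pt_len Hmk ?lexx ?ltW ?len_gt0.
have /card_gt0P[v1 _] := vertex_neq0 G.
have [v0 /= v0max] : exists v0, forall v, f (Vertex v) <= f (Vertex v0).
  exists [arg max_(v > v1) f (Vertex v)]%O => v.
  by case: arg_maxP => // i _; apply.
have src_max e : f (Vertex (src e)) = f (Vertex v0) -> m e <= 0.
  by move=> E; have := v0max (tgt e); rewrite ftgt E; have := len_gt0 e; nra.
have tgt_max e : f (Vertex (tgt e)) = f (Vertex v0) -> - m e <= 0.
  move=> E; have := v0max (src e); have := len_gt0 e; have := ftgt e.
  by rewrite E; nra.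
have flat v : f (Vertex v) = f (Vertex v0) ->
    (forall e, src e == v -> m e = 0) /\ (forall e, tgt e == v -> m e = 0).
  move=> vmax; have := hf (Vertex v); rewrite /laplacian /=.
  rewrite (eq_bigr m) // (eq_bigr (P := fun e => tgt e == v) (fun e => - m e)) //.
  move=> H.
  have S1 : 0 <= \sum_(e | src e == v) - m e.
    by apply: sumr_ge0 => e /eqP ev; rewrite oppr_ge0 src_max // ev.
  have S2 : 0 <= \sum_(e | tgt e == v) m e.
    by apply: sumr_ge0 => e /eqP ev; rewrite -oppr_le0 tgt_max // ev.
  rewrite sumrN in S1; rewrite sumrN in H.
  split=> e ev.
    apply/eqP; rewrite -oppr_eq0; apply/eqP; move: e ev.
    apply: psumr_eq0P => [e /eqP ev|]; first by rewrite oppr_ge0 src_max // ev.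
    by rewrite sumrN; lra.
  move: e ev; apply: psumr_eq0P => [e /eqP ev|]; last by lra.
  by rewrite -oppr_le0 tgt_max // ev.
(* Maximality passes along edges, so by connectedness it holds at every vertex. *)
have flat_edge e : (f (Vertex (src e)) == f (Vertex v0))
                 = (f (Vertex (tgt e)) == f (Vertex v0)).
  apply/eqP/eqP => /[dup] E /flat[F F'].
    by rewrite ftgt F // mul0r add0r.
  by rewrite -E ftgt F' // mul0r add0r.
have fV v : f (Vertex v) = f (Vertex v0).
  apply/eqP; rewrite -[_ == _]/(v \in [pred u | f (Vertex u) == f (Vertex v0)]).
  rewrite -(closed_connect _ (graph_connected v0 v)) ?inE // => u w.
  by case/existsP=> e /orP[] /andP[/eqP <- /eqP <-]; rewrite !inE flat_edge.
exists (f (Vertex v0)) => -[v|e x xe]; first exact: fV.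
have [m0 _] := flat _ (fV (src e)).
rewrite Inner_edge_pt Hmk; last lra.
by rewrite -fsrc -/(m e) m0 // mul0r add0r.
Qed.

Lemma laplacian_inj f g : piecewise_linear f -> piecewise_linear g ->
  (forall p, laplacian f p = laplacian g p) ->
  exists k, forall p, f p = g p + k.
Proof.
move=> plf plg fg.
have [p|k Hk] := harmonic_cst _ (pl_sub _ _ plf plg).
  by rewrite laplacian_sub // fg subrr.
by exists k => p; have := Hk p; lra.
Qed.

End Graph.

(** * Tropical convexity *)

Section Convexity.
Variables (R : realType) (G : metric_graph R) (d : R).
Implicit Types (D E : divisor G) (T S : set (divisor G)) (f g h k : gpoint G -> R).

(** * Segments as minima of potentials *)

(* The base point of the potentials is the element of the segment itself, which
   makes the two potentials have minimum zero. *)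
Lemma tsegmentP D1 D2 D : tsegment D1 D2 D -> exists k1 k2,
  [/\ piecewise_linear k1, piecewise_linear k2, D1 = D \+ laplacian k1,
      D2 = D \+ laplacian k2 & forall p, Num.min (k1 p) (k2 p) = 0].
Proof.
case=> f [plf lf] [t _ <-]; pose c := t * (fmax f - fmin f).
pose f0 := fun p => f p - fmin f.
pose u := fun p => Num.min c (f0 p).
have plf0 : piecewise_linear f0 by apply: pl_sub => //; apply: pl_cst.
have plc := pl_cst _ G c.
have plu : piecewise_linear u by apply: pl_min.
(* Here [D] is [D1 \+ laplacian u]; both potentials are shifted by [- u], and [u] is the minimum of
   [c] and [f0]. *)
exists (fun p => c - u p), (fun p => f0 p - u p).
split; [exact: pl_sub|exact: pl_sub| | |].
- apply/funext => p; rewrite /tpath /= -/c -/u laplacian_sub //.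
  by rewrite laplacian_cst; ring.
- have /(congr1 (@^~ _)) lfp := lf.
  apply/funext => p; rewrite /tpath /= -/c -/u laplacian_sub // laplacian_sub //.
    by rewrite laplacian_cst lfp /=; ring.
  exact: pl_cst.
- by move=> p; rewrite /u; case: (leP c (f0 p)) => ?; case: leP => ?; lra.
Qed.

(** With f = h2 - h1 one has min(h1, h2) = h1 + min(0, f), and the segment consists of the
    truncations of [f]. *)
Lemma tsegment_min D h1 h2 : piecewise_linear h1 -> piecewise_linear h2 ->
  tsegment (D \+ laplacian h1) (D \+ laplacian h2)
    (D \+ laplacian (fun p => Num.min (h1 p) (h2 p))).
Proof.
move=> pl1 pl2; pose f := fun p => h2 p - h1 p.
have plf : piecewise_linear f by apply: pl_sub.
have [M HM] := pl_bounded _ _ _ plf.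
have fle p : f p <= fmax f.
  apply: ub_le_sup; last by exists p.
  by exists M => _ [q _ <-]; rewrite (le_trans (ler_norm _)).
have lef p : fmin f <= f p.
  apply: ge_inf; last by exists p.
  by exists (- M) => _ [q _ <-]; have := HM q; rewrite ler_norml => /andP[].
have /card_gt0P[v _] := vertex_neq0 G.
have ab : fmin f <= fmax f := le_trans (lef (Vertex v)) (fle (Vertex v)).
(* The level 0 may fall outside the range of [f]. It is then replaced by the nearest end of the
   range, which changes the truncation by a constant only. *)
have [c [acb [l Hl]]] : exists c, fmin f <= c <= fmax f /\
    exists l, forall p, Num.min (c - fmin f) (f p - fmin f) = Num.min 0 (f p) + l.
  case: (ltP 0 (fmin f)) => a0.
    exists (fmin f); split; first by rewrite lexx.
    exists 0 => p; have ? := lef p; case: leP => ?; case: leP => ?; lra.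
  case: (ltP (fmax f) 0) => b0.
    exists (fmax f); split; first by rewrite lexx ab.
    exists (- fmin f) => p; have ? := fle p; case: leP => ?; case: leP => ?; lra.
  exists 0; split; first by rewrite a0.
  by exists (- fmin f) => p; case: leP => ?; case: leP => ?; lra.
have [t t01 tE] : exists2 t, 0 <= t <= 1 & t * (fmax f - fmin f) = c - fmin f.
  (* For constant [f] the path is constant and the quotient defining [t] degenerates, so [t] is
     taken to be 0. *)
  have [abE|abN] := eqVneq (fmax f) (fmin f).
    by exists 0; [rewrite lexx ler01|rewrite mul0r; lra].
  have ab0 : 0 < fmax f - fmin f by rewrite subr_gt0 lt_def abN.
  exists ((c - fmin f) / (fmax f - fmin f)).
    by rewrite divr_ge0 ?ler_pdivrMr //; lra.
  by rewrite divfK // gt_eqF.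
exists f.
  by split=> //; apply/funext => p; rewrite laplacian_sub //=; ring.
exists t; first by rewrite /= in_itv.
have pl0 := pl_cst _ G 0.
have pll := pl_cst _ G l.
have plm : piecewise_linear (fun p => Num.min 0 (f p)) by apply: pl_min.
have -> : (fun p => Num.min (h1 p) (h2 p)) = fun p => h1 p + Num.min 0 (f p).
  by apply/funext => p; rewrite /f; case: leP => ?; case: leP => ?; lra.
rewrite /tpath tE (funext Hl).
apply/funext => p /=; rewrite !laplacian_add // laplacian_cst; ring.
Qed.

Lemma tconvex_min T D h1 h2 : tconvex d T ->
  piecewise_linear h1 -> piecewise_linear h2 ->
  T (D \+ laplacian h1) -> T (D \+ laplacian h2) ->
  T (D \+ laplacian (fun p => Num.min (h1 p) (h2 p))).
Proof.
by move=> [_ cT] pl1 pl2 T1 T2; apply: cT T1 T2 _ _; apply: tsegment_min.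
Qed.

(** If no tropically convex set contains [S], the intersection is over an empty family and gives all
    divisors. The hypothesis rules this out, and spares a proof that segments between effective
    divisors are effective. *)
Lemma tconv_tconvex S : tconv d S `<=` eff_div d -> tconvex d (tconv d S).
Proof.
move=> Sd; split=> // D1 D2 T1 T2 D D12 A [cA SA].
by have [_] := cA; apply; [apply: T1|apply: T2|exact: D12].
Qed.

Lemma tconv_min S T : tconvex d T -> S `<=` T -> tconv d S `<=` T.
Proof. exact: smallest_sub. Qed.

Lemma sub_tconv S : S `<=` tconv d S.
Proof. exact: sub_gen_smallest. Qed.

(** * The cone over a tropically convex set *)

(* The potentials, relative to [D], of the elements of the tropical convex hull
   of [D] and [T]. *)
Definition cone_potential T D h :=
  (exists k : R, h = fun=> k) \/
  exists (c : R) g, [/\ piecewise_linear g, T (D \+ laplacian g)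
                      & h = fun p => Num.min c (g p)].

(** Elements of [T] are included directly, so that no potential linking them to [D] has to be known
    to exist. *)
Definition cone T D : set (divisor G) :=
  [set E | T E \/ exists2 h, cone_potential T D h & E = D \+ laplacian h].

Lemma cone_potential_pl T D h : cone_potential T D h -> piecewise_linear h.
Proof.
case=> [[k ->]|[c [g [plg _ ->]]]]; first exact: pl_cst.
by apply: pl_min => //; apply: pl_cst.
Qed.

Lemma cone_potential_addc T D h (l : R) : cone_potential T D h ->
  cone_potential T D (fun p => h p + l).
Proof.
case=> [[k ->]|[c [g [plg Tg ->]]]]; first by left; exists (k + l).
right; exists (c + l), (fun p => g p + l); split.
- by apply: pl_add => //; apply: pl_cst.
- by rewrite laplacian_addc.
- by apply/funext => p; rewrite addr_minl.
Qed.

Lemma cone_potential_min T D h1 h2 : tconvex d T ->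
  cone_potential T D h1 -> cone_potential T D h2 ->
  cone_potential T D (fun p => Num.min (h1 p) (h2 p)).
Proof.
move=> cT [[k1 ->]|[c1 [g1 [pl1 T1 ->]]]] [[k2 ->]|[c2 [g2 [pl2 T2 ->]]]].
- by left; exists (Num.min k1 k2).
- right; exists (Num.min k1 c2), g2; split=> //.
  by apply/funext => p; rewrite minA.
- right; exists (Num.min c1 k2), g1; split=> //.
  by apply/funext => p; rewrite minAC.
- right; exists (Num.min c1 c2), (fun p => Num.min (g1 p) (g2 p)); split.
  + exact: pl_min.
  + exact: tconvex_min.
  + by apply/funext => p; rewrite minACA.
Qed.

Lemma cone_potentialP T D h : piecewise_linear h ->
  cone T D (D \+ laplacian h) -> cone_potential T D h.
Proof.
move=> plh [Th|[h' ch' /(congr1 (@^~ _)) Eh]].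
  (* Truncating [h] at an upper bound [M] leaves it unchanged. *)
  have [M HM] := pl_bounded _ _ _ plh.
  right; exists M, h; split=> //; apply/funext => p.
  by rewrite min_r // (le_trans (ler_norm _)).
have [p|l Hl] := laplacian_inj _ _ _ _ plh (cone_potential_pl _ _ _ ch').
  by have /addrI := Eh p.
by rewrite (funext Hl); apply: cone_potential_addc.
Qed.

Lemma cone_sub T' T D : tconvex d T -> T' `<=` T -> T D -> cone T' D `<=` T.
Proof.
move=> cT T'T TD E [/T'T//|[h ch ->]].
have Tcst (l : R) : T (D \+ laplacian (fun=> l)).
  by rewrite (_ : _ \+ _ = D) //; apply/funext => p; rewrite /= laplacian_cst addr0.
case: ch => [[k ->] //|[c [g [plg Tg ->]]]].
by apply: tconvex_min => //; [apply: pl_cst|apply: T'T].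
Qed.

(** Let E = D + laplacian h lie on the segment, the ends having potentials [k1], [k2] relative to
    [E] with minimum zero. Relative to [D] these become h + k1 and h + k2, whose minimum is [h], and
    cone potentials are stable under minimum. *)
Lemma cone_tconvex T' T D : tconvex d T -> tconvex d T' -> T' `<=` T -> T D ->
  tconvex d (cone T' D).
Proof.
move=> cT cT' T'T TD; split.
  by apply: subset_trans (cone_sub _ _ _ cT T'T TD) _; case: cT.
move=> D1 D2 C1 C2 E E12.
have [k1 [k2 [pl1 pl2 D1E D2E k0]]] := tsegmentP _ _ _ E12.
have [[h plh EE]|nlink] :=
    pselect (exists2 h, piecewise_linear h & E = D \+ laplacian h); last first.
  (* If [E] is not linked to [D], neither end is, so both ends lie in [T']. *)
  have inT' k Dk : piecewise_linear k -> Dk = E \+ laplacian k ->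
      cone T' D Dk -> T' Dk.
    move=> plk DkE [//|[h ch Dkh]]; case: nlink.
    have plh := cone_potential_pl _ _ _ ch.
    exists (fun p => h p - k p); first exact: pl_sub.
    apply/funext => p; rewrite /= laplacian_sub //.
    by have := congr1 (@^~ p) Dkh; rewrite DkE /=; lra.
  left; case: cT' => _; apply; last exact: E12.
    exact: inT' pl1 _ _.
  exact: inT' pl2 _ _.
have potE k Dk : piecewise_linear k -> Dk = E \+ laplacian k ->
    cone T' D Dk -> cone_potential T' D (fun p => h p + k p).
  move=> plk DkE CDk; apply: cone_potentialP; first exact: pl_add.
  move: CDk; rewrite DkE EE; congr (cone T' D); apply/funext => p /=.
  by rewrite laplacian_add // addrA.
right; exists h => //.
have := cone_potential_min _ _ _ _ cT' (potE _ _ pl1 D1E C1) (potE _ _ pl2 D2E C2).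
congr cone_potential; apply/funext => p.
by have := k0 p; case: leP => ?; case: leP => ?; lra.
Qed.

(* If [D] were in the segment [D1, D2], then the potentials of [D1] and [D2]
   would be [min c1 g1] and [min c2 g2] with minimum zero; as neither vanishes,
   [c1] and [c2] are positive, so already [min g1 g2 = 0] and [D] is in [T']. *)
Lemma tconvex_setD1 T' T D : tconvex d T -> tconvex d T' -> ~ T' D ->
  T `<=` cone T' D -> tconvex d (T `\ D).
Proof.
move=> cT cT' nT'D TC; split; first by move=> E [/(proj1 cT)].
move=> D1 D2 [T1 D1D] [T2 D2D] E E12; split; first exact: (proj2 cT) E12.
move=> /= ED; move: E12; rewrite ED => /tsegmentP[k1 [k2 [pl1 pl2 D1E D2E k0]]].
have potE k Dk : piecewise_linear k -> Dk = D \+ laplacian k -> T Dk ->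
    Dk <> D -> (forall p, 0 <= k p) -> exists (c : R) g,
    [/\ 0 < c, piecewise_linear g, T' (D \+ laplacian g)
      & k = fun p => Num.min c (g p)].
  move=> plk DkE /TC; rewrite DkE => /(cone_potentialP _ _ _ plk).
  have nz (l : R) : D \+ laplacian (fun=> l) = D.
    by apply/funext => p; rewrite /= laplacian_cst addr0.
  case=> [[l ->] /(_ (nz l)) //|[c [g [plg T'g kE]]] DkD kge0].
  exists c, g; split=> //.
  have /card_gt0P[v _] := vertex_neq0 G.
  have c0 : 0 <= c.
    by have := kge0 (Vertex v); rewrite kE le_min => /andP[].
  rewrite lt_def c0 andbT; apply/eqP => cE; apply: DkD.
  rewrite (_ : k = fun=> 0) //; apply/funext => p; apply/le_anti.
  by rewrite kge0 andbT kE cE ge_min lexx.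
have [p|c1 [g1 [c10 plg1 T1g k1E]]] := potE _ _ pl1 D1E T1 D1D.
  by rewrite -(k0 p) ge_min lexx.
have [p|c2 [g2 [c20 plg2 T2g k2E]]] := potE _ _ pl2 D2E T2 D2D.
  by rewrite -(k0 p) ge_min lexx orbT.
apply: nT'D; have := tconvex_min _ _ _ _ cT' plg1 plg2 T1g T2g.
congr T'; apply/funext => p /=.
rewrite (_ : (fun q => _) = fun=> 0); first by rewrite laplacian_cst addr0.
apply/funext => q; have := k0 q; rewrite k1E k2E minACA.
by case: (leP c1) => ?; case: (leP (g1 q)) => ?; case: leP => ?; lra.
Qed.

(** * Extremals and generating sets *)

Lemma extremals_generator S T : tconv d S = T -> extremals d T `<=` S.
Proof.
move=> ST D [TD nD]; apply: contrapT => nSD; apply: nD.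
(* Since [S] misses [D], a tropically convex set containing [T] without [D] contains [S], hence the
   whole of [T], including [D]. *)
move: (TD); rewrite -{1}ST => TD' A [cA sA]; apply: TD'; split=> // E SE.
apply: sA; split; first by rewrite -ST; apply: sub_tconv.
by move=> /= ED; apply: nSD; rewrite -ED.
Qed.

(** If the other generators did not produce [D], the hull without [D] would still be tropically
    convex, and [D] would be extremal. *)
Lemma tconv_setD1 S D : tconv d S `<=` eff_div d -> S D ->
  ~ extremals d (tconv d S) D -> tconv d (S `\ D) = tconv d S.
Proof.
set T := tconv d S => Td SD nD.
have cT : tconvex d T by apply: tconv_tconvex.
have TD : T D by apply: sub_tconv.
have ST : S `\ D `<=` T by move=> E [SE _]; apply: sub_tconv.
have T'T : tconv d (S `\ D) `<=` T by apply: tconv_min.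
have cT' : tconvex d (tconv d (S `\ D)).
  by apply: tconv_tconvex; apply: subset_trans Td.
apply/seteqP; split=> //; apply: tconv_min => // E SE.
have [->|ED] := pselect (E = D); last by apply: sub_tconv.
apply: contrapT => nT'D; apply: nD; split=> // DT.
(* The cone is tropically convex and contains all generators, [D] itself through the zero
   potential. *)
have TC : T `<=` cone (tconv d (S `\ D)) D.
  apply: tconv_min; first exact: cone_tconvex cT cT' T'T TD.
  move=> F SF; have [->|FD] := pselect (F = D); last by left; apply: sub_tconv.
  right; exists (fun=> 0); first by left; exists 0.
  by apply/funext => p; rewrite /= laplacian_cst addr0.
have cTD := tconvex_setD1 _ _ _ cT cT' nT'D TC.
by have [_] := tconv_min (T `\ D) _ cTD (fun _ => id) _ DT; apply.
Qed.

Lemma tconv_extremals S : finite_set S -> tconv d S `<=` eff_div d ->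
  tconv d (extremals d (tconv d S)) = tconv d S.
Proof.
move=> /finite_seqP[s ->]; have [n] := ubnP (size s).
elim: n s => // n IH s sn Td; set T := tconv d [set` s].
(* Either a non-extremal generator is dropped, with all its copies in [s], or all generators are
   extremal and the extremals generate. *)
have [[D [sD nD]]|allext] := pselect (exists D, D \in s /\ ~ extremals d T D).
  have E := tconv_setD1 _ D Td sD nD.
  have sE : [set` s] `\ D = [set` [seq F <- s | F != D]].
    apply/seteqP; split=> F /=; rewrite mem_filter /=.
      by case=> Fs /eqP FD; rewrite FD.
    by case/andP=> /eqP ? ->.
  rewrite /T -E sE; apply: IH; last by rewrite -sE E.
  rewrite ltnS in sn; apply: leq_trans sn.
  rewrite size_filter -(count_predC (pred1 D) s) -addn1 addnC leq_add2r.
  by rewrite -has_count has_pred1.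
have cT : tconvex d T by apply: tconv_tconvex.
have extT : tconv d (extremals d T) `<=` T.
  by apply: tconv_min cT _ => D [].
apply/seteqP; split=> //; apply: tconv_min.
  exact: tconv_tconvex (subset_trans extT Td).
move=> D sD; apply: sub_tconv; apply: contrapT => nD.
by apply: allext; exists D.
Qed.

End Convexity.

Theorem theorem7p2 (R : realType) (G : metric_graph R) (d : R)
    (d_ge0 : 0 <= d) (T : set (divisor G)) (T_div : T `<=` eff_div d)
    (T_fin : exists S0 : set (divisor G), finite_set S0 /\ tconv d S0 = T) :
  [/\ finite_set (extremals d T),
      tconv d (extremals d T) = T
    & forall S' : set (divisor G), tconv d S' = T -> extremals d T `<=` S'].
Proof.
have [S0 [S0fin S0T]] := T_fin.
split.
- exact: sub_finite_set (extremals_generator _ _ _ _ _ S0T) S0fin.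
- by rewrite -S0T; apply: tconv_extremals => //; rewrite S0T.
- by move=> S'; apply: extremals_generator.
Qed.
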